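(* Let $G$ be a cellular embedding of a graph in a surface, and let $\psi_{\mathrm p}$ be the invariant of edgeless pseudocellular embeddings given by $\psi_{\mathrm p}(F)=t^{p(F)}$, where $p(F)$ is the number of pinchcomponents of the underlying pseudosurface of $F$ (equivalently, the number of free loops of its jewel). Then $$Q(G,(\alpha,\beta,\gamma),t)=\Psi\big(G,(\alpha,\beta,\gamma,0,0;0,0,0,0,0),\psi_{\mathrm p}\big),$$ where $Q$ is the topological transition polynomial and $\Psi$ is the transition-merger polynomial.
   Context: Graphs are finite, with loops and multiple edges allowed. A pseudosurface is obtained from a compact surface (a $2$-manifold, possibly disconnected) by identifying finitely many finite sets of points; an identified point arising from $m\ge 2$ points is a pinchpoint of pinchdegree $m$. The images of the components of the original surface are the pinchcomponents. An open $m$-disk is $m$ open disks with their centers identified. An embedding of a graph in a pseudosurface is pseudocellular if every face (component of the complement of the graph) is homeomorphic to an open $m$-disk for some $m\ge1$, and the interior of each edge either contains no pinchpoint (cellular edge) or contains exactly one pinchpoint, which has pinchdegree $2$ and is crossed by the edge from one of its two local disks to the other (cross-pinched edge). Vertices may be at pinchpoints. A cellular embedding in a surface (all faces open disks) is a special case. Combinatorial representation. Up to homeomorphism, an edge-labeled pseudocellular embedding is given by an edge-colored graph (jewel) $J$ with three partitions. All edges of $J$ have colors in $\{\mathsf a,\mathsf v,\mathsf f,\mathsf z\}$, each vertex is incident with exactly one edge of each color, $J$ may also contain free loops (vertexless circles) of color $\mathsf a$, and every component of the subgraph of edges of colors $\mathsf v,\mathsf f,\mathsf z$ is either a properly $3$-edge-colored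 $K_4$ (an e-square) or two vertices joined by three parallel edges of colors $\mathsf v,\mathsf f,\mathsf z$ (a semiedge-digon). A v-gon (f-gon) is a cycle alternating colors $\mathsf a,\mathsf v$ (respectively $\mathsf a,\mathsf f$); each free loop is both a v-gon and an f-gon. There are a partition of the set of v-gons (parts = vertices of the embedded graph), a partition of the set of f-gons (parts = faces), and a partition of the semiedge-digons into pairs. Cellular edges $e$ correspond to e-squares and cross-pinched edges to pairs of semiedge-digons; this subgraph is denoted $S_e$. Cellular embeddings in surfaces correspond to jewels with no semiedge-digons and with all v-gon and f-gon partitions discrete. Edgeless embeddings correspond to jewels consisting only of free loops; each free loop is one pinchcomponent. Operations. To smooth $S_e$ along a color $c\in\{\mathsf v,\mathsf f,\mathsf z\}$: delete all edges of $S_e$ not of color $c$, recolor its two edges of color $c$ with $\mathsf a$, then replace each maximal path of $\mathsf a$-edges by a single $\mathsf a$-edge and each cycle of $\mathsf a$-edges by a free loop. v-gons and f-gons not meeting $S_e$ persist in their parts. To ''merge v'' means: merge into one part all parts containing v-gons that meet $S_e$, and replace in it the old v-gons meeting $S_e$ by the new v-gon(s) passing through the two replacement edges. If v is not merged, each old v-gon meeting $S_e$ persists as a unique (shortened) new v-gon in the same part. ''Merge f'' is analogous for f-gons. For a cellular edge $e$, the quotient-based (Q) operations are: contraction (smooth along $\mathsf f$, merge v); deletion (smooth along $\mathsf v$, merge f); twist-contraction (smooth along $\mathsf z$, merge v and merge f); supercontraction (smooth along $\mathsf f$, merge v and f); superdeletion (smooth along $\mathsf v$, merge v and f). For cross-pinched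 edges there are five further operations (contraction, deletion, twist-contraction, erasure, swirling), which are not needed for embeddings all of whose edges are cellular, since the operations above keep all other edges cellular. Operations on distinct edges commute, so they can be applied to sets of edges. $\Psi$. For an invariant $\psi$ of edgeless pseudocellular embeddings, and for an embedding $G$ all of whose edges are cellular, $\Psi(G,(x_{\mathrm c},x_{\mathrm d},x_{\mathrm t},x_{\mathrm{sc}},x_{\mathrm{sd}};y_{\mathrm c},y_{\mathrm d},y_{\mathrm t},y_{\mathrm e},y_{\mathrm w}),\psi)$ is the sum, over all ordered partitions $(A_{\mathrm c},A_{\mathrm d},A_{\mathrm t},A_{\mathrm{sc}},A_{\mathrm{sd}})$ of $E(G)$ (parts may be empty), of $x_{\mathrm c}^{|A_{\mathrm c}|}x_{\mathrm d}^{|A_{\mathrm d}|}x_{\mathrm t}^{|A_{\mathrm t}|}x_{\mathrm{sc}}^{|A_{\mathrm{sc}}|}x_{\mathrm{sd}}^{|A_{\mathrm{sd}}|}\,\psi(G')$, where $G'$ is the edgeless embedding obtained from $G$ by Q contracting $A_{\mathrm c}$, Q deleting $A_{\mathrm d}$, Q twist-contracting $A_{\mathrm t}$, Q supercontracting $A_{\mathrm{sc}}$ and Q superdeleting $A_{\mathrm{sd}}$. Convention: $0^0=1$. $Q$. For a cellular embedding $G$ in a surface (jewel with discrete v-gon and f-gon partitions, so no partitions are recorded), the BR (Bollobás–Riordan) contraction, deletion and twist-contraction of $e$ smooth $S_e$ along $\mathsf f$, $\mathsf v$, $\mathsf z$, respectively, with the v-gon and f-gon partitions of the result again discrete. Then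 $Q(G,(\alpha,\beta,\gamma),t)=\sum_{(A,B,C)}\alpha^{|A|}\beta^{|B|}\gamma^{|C|}\,t^{c(G_{A,B,C})}$, summed over ordered partitions $(A,B,C)$ of $E(G)$ (parts may be empty), where $G_{A,B,C}$ is obtained from $G$ by BR contracting $A$, BR deleting $B$ and BR twist-contracting $C$, and $c$ is the number of components of the resulting (edgeless) embedded graph, i.e. its number of vertices. *)

(* Defs.v *)
From HB Require Import structures.
From mathcomp Require Import all_boot all_order all_algebra.
Set Implicit Arguments. Unset Strict Implicit. Unset Printing Implicit Defensive.
Import GRing.Theory.
Local Open Scope ring_scope.

Variant color := Ca | Cv | Cf | Cz.

(* Raw data of an edge-labeled jewel. The edges of color c form a perfect
   matching of the vertices, given by the map [mate c] sending a vertex to the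
   other end of its edge of color c. The subgraph S_e of an edge label e is
   carried by the vertices labeled e; in particular the pairing of the
   semiedge-digons is recorded by giving paired digons the same label.
   The axioms are in [is_jewel]. *)
Record jewel (E : finType) := Jewel {
  vert : finType;
  loop : finType; (* free loops *)
  mate : color -> vert -> vert;
  lab : vert -> E
}.
Arguments mate {E} j c x.
Arguments lab {E} j x.

Definition edges (E : finType) (J : jewel E) : {set E} :=
  [set lab J x | x : vert J].

Definition Ssub (E : finType) (J : jewel E) (e : E) : {set vert J} :=
  [set x | lab J x == e].

(* A properly 3-edge-colored K_4; the equations say that the edge opposite to
   the edge of a given color at x has that same color. *)
Definition esquare (E : finType) (J : jewel E) (S : {set vert J}) : Prop :=
  exists x : vert J,
    let xv := mate J Cv x in let xf := mate J Cf x in let xz := mate J Cz x in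
    [/\ S = [set x; xv; xf; xz], uniq [:: x; xv; xf; xz],
        mate J Cv xf = xz, mate J Cf xv = xz & mate J Cz xv = xf].

Definition semiedge_digon (E : finType) (J : jewel E) (S : {set vert J}) : Prop :=
  exists x : vert J,
    [/\ S = [set x; mate J Cv x], mate J Cf x = mate J Cv x
      & mate J Cz x = mate J Cv x].

Definition cellular_edge (E : finType) (J : jewel E) (e : E) : Prop :=
  esquare (Ssub J e).

Definition cross_pinched_edge (E : finType) (J : jewel E) (e : E) : Prop :=
  exists D1 D2 : {set vert J},
    [/\ semiedge_digon D1, semiedge_digon D2, D1 != D2 & Ssub J e = D1 :|: D2].

Definition is_jewel (E : finType) (J : jewel E) : Prop :=
  [/\ forall c, involutive (mate J c),
      forall c x, mate J c x != x
    & forall e, e \in edges J -> cellular_edge J e \/ cross_pinched_edge J e].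

(* Cycles alternating the colors a and c are the components of the subgraph of
   edges of these two colors, and are identified with their vertex sets; they
   are embedded in [vert J + loop J] so that a free loop l is the gon {l}.
   [gons J Cv] are the v-gons and [gons J Cf] the f-gons. *)
Definition gon_at (E : finType) (J : jewel E) (c : color) (x : vert J) :
    {set vert J + loop J} :=
  [set inl y | y : vert J &
    connect [rel u w | (w == mate J Ca u) || (w == mate J c u)] x y].

Definition gons (E : finType) (J : jewel E) (c : color) :
    {set {set vert J + loop J}} :=
  [set gon_at c x | x : vert J] :|: [set [set inr l] | l : loop J].

(* [vpart] is the partition of the v-gons (its parts are the vertices of the
   embedded graph) and [fpart] that of the f-gons (its parts are the faces). *)
Record embedding (E : finType) := Embedding {
  jewel_of :> jewel E;
  vpart : {set {set {set vert jewel_of + loop jewel_of}}};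
  fpart : {set {set {set vert jewel_of + loop jewel_of}}}
}.

Definition pseudocellular_embedding (E : finType) (G : embedding E) : Prop :=
  [/\ is_jewel G, partition (vpart G) (gons G Cv)
    & partition (fpart G) (gons G Cf)].

Definition discrete_part (E : finType) (J : jewel E) (c : color) :
    {set {set {set vert J + loop J}}} :=
  [set [set g] | g in gons J c].

Definition discrete_embedding (E : finType) (J : jewel E) : embedding E :=
  @Embedding E J (discrete_part J Cv) (discrete_part J Cf).

Definition cellular_embedding (E : finType) (G : embedding E) : Prop :=
  [/\ pseudocellular_embedding G,
      forall e, e \in edges G -> cellular_edge G e,
      vpart G = discrete_part G Cv & fpart G = discrete_part G Cf].

Definition meets (E : finType) (J : jewel E) (e : E)
    (g : {set vert J + loop J}) : bool :=
  [exists x in Ssub J e, inl x \in g].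

(* After the edges of color c of S_e have been recolored with a, and the other
   edges of S_e deleted, [atrail J c e x] is the component of x in the subgraph
   of edges of color a: a maximal path with its two ends outside S_e, or a
   cycle contained in S_e. *)
Definition atrail (E : finType) (J : jewel E) (c : color) (e : E)
    (x : vert J) : {set vert J} :=
  [set y | connect [rel u w | (w == mate J Ca u) ||
                              (u \in Ssub J e) && (w == mate J c u)] x y].

Definition smooth_vert (E : finType) (J : jewel E) (e : E) : finType :=
  {x : vert J | x \notin Ssub J e}.

Definition acycle (E : finType) (J : jewel E) (c : color) (e : E) : finType :=
  {C : {set vert J} | (C \in [set atrail c e x | x : vert J])
                      && (C \subset Ssub J e)}.

Definition smooth_loop (E : finType) (J : jewel E) (c : color) (e : E) : finType :=
  (loop J + acycle J c e)%type.

(* The default values of [insubd] and [odflt] are irrelevant on a jewel: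
   edges of color v, f, z do not leave S_e, and each maximal a-path has exactly
   two ends. *)
Definition smooth_mate (E : finType) (J : jewel E) (c : color) (e : E)
    (d : color) (x : smooth_vert J e) : smooth_vert J e :=
  if d is Ca then
    odflt x [pick y : smooth_vert J e | (y != x) && (val y \in atrail c e (val x))]
  else insubd x (mate J d (val x)).

Definition smooth (E : finType) (J : jewel E) (c : color) (e : E) : jewel E :=
  @Jewel E (smooth_vert J e) (smooth_loop J c e) (@smooth_mate E J c e)
    (fun x => lab J (val x)).

(* The old vertices and free loops through which a gon of the smoothed jewel
   passes, including the vertices of S_e suppressed from its a-paths and
   a-cycles. For a gon avoiding the replacement edges this is an old gon; for a
   c-gon after smoothing along c it is the old c-gon that persists as it. *)
Definition trace_elt (E : finType) (J : jewel E) (c : color) (e : E)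
    (u : vert (smooth J c e) + loop (smooth J c e)) : {set vert J + loop J} :=
  match u with
  | inl x => [set inl y | y in atrail c e (val x)]
  | inr (inl l) => [set inr l]
  | inr (inr C) => [set inl y | y in val C]
  end.

Definition trace (E : finType) (J : jewel E) (c : color) (e : E)
    (g : {set vert (smooth J c e) + loop (smooth J c e)}) :
    {set vert J + loop J} :=
  \bigcup_(u in g) trace_elt u.

(* P is a partition of the d-gons of J; the results are partitions of the
   d-gons of J smoothed along c at S_e. *)
Definition keep_part (E : finType) (J : jewel E) (c : color) (e : E) (d : color)
    (P : {set {set {set vert J + loop J}}}) :
    {set {set {set vert (smooth J c e) + loop (smooth J c e)}}} :=
  [set [set g in gons (smooth J c e) d | trace g \in p] | p : {set _} in P].

Definition merge_part (E : finType) (J : jewel E) (c : color) (e : E) (d : color)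
    (P : {set {set {set vert J + loop J}}}) :
    {set {set {set vert (smooth J c e) + loop (smooth J c e)}}} :=
  let M := [set p : {set {set vert J + loop J}} in P | [exists g in p, meets e g]] in
  [set g in gons (smooth J c e) d | (trace g \in cover M) || meets e (trace g)]
    |: keep_part c e d (P :\: M).

Definition Qop (E : finType) (c : color) (mergev mergef : bool)
    (e : E) (G : embedding E) : embedding E :=
  @Embedding E (smooth G c e)
    ((if mergev then merge_part else keep_part) E G c e Cv (vpart G))
    ((if mergef then merge_part else keep_part) E G c e Cf (fpart G)).

Definition Qcontract (E : finType) := @Qop E Cf true false.
Definition Qdelete (E : finType) := @Qop E Cv false true.
Definition Qtwist_contract (E : finType) := @Qop E Cz true true.
Definition Qsupercontract (E : finType) := @Qop E Cf true true.
Definition Qsuperdelete (E : finType) := @Qop E Cv true true.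

Definition BRop (E : finType) (c : color) (e : E) (G : embedding E) : embedding E :=
  discrete_embedding (smooth G c e).

Definition BRcontract (E : finType) := @BRop E Cf.
Definition BRdelete (E : finType) := @BRop E Cv.
Definition BRtwist_contract (E : finType) := @BRop E Cz.

Definition on_set (E : finType) (op : E -> embedding E -> embedding E)
    (A : {set E}) (G : embedding E) : embedding E :=
  foldl (fun H e => op e H) G (enum A).

Definition ordered_partition (E : finType) (S : {set E}) (As : seq {set E}) : bool :=
  (\bigcup_(A <- As) A == S) && pairwise (fun A B : {set E} => [disjoint A & B]) As.

(* Number of components of the embedded graph: two vertices are adjacent when
   they are ends of a common edge. *)
Definition num_components (E : finType) (G : embedding E) : nat :=
  n_comp [rel p q : {set {set vert G + loop G}} |
            [&& p \in vpart G, q \in vpart G &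
             [exists e, [exists g in p, meets e g] && [exists g in q, meets e g]]]]
         (mem (vpart G)).

(* The pinchcomponents are the components of the jewel, each free loop being
   one of them. *)
Definition num_pinchcomponents (E : finType) (G : embedding E) : nat :=
  (n_comp [rel x y : vert G | [|| y == mate G Ca x, y == mate G Cv x,
                                  y == mate G Cf x | y == mate G Cz x]]
          (predT : pred (vert G)) + #|loop G|)%N.

Definition psi_p (R : comNzRingType) (E : finType) (t : R) (F : embedding E) : R :=
  t ^+ num_pinchcomponents F.

(* The topological transition polynomial of a cellular embedding. *)
Definition Qpoly (R : comNzRingType) (E : finType) (G : embedding E)
    (w : R * R * R) (t : R) : R :=
  let: (alpha, beta, gamma) := w in
  \sum_(A : {set E}) \sum_(B : {set E})
  \sum_(C : {set E} | ordered_partition (edges G) [:: A; B; C])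
    alpha ^+ #|A| * beta ^+ #|B| * gamma ^+ #|C| *
    t ^+ num_components
      (on_set (@BRtwist_contract E) C
         (on_set (@BRdelete E) B (on_set (@BRcontract E) A G))).

(* The transition-merger polynomial of an embedding all of whose edges are
   cellular; [y] holds the weights (c, d, t, e, w) of the operations on
   cross-pinched edges, which do not occur in this case. *)
Definition Psi (R : comNzRingType) (E : finType) (G : embedding E)
    (x y : R * R * R * R * R) (psi : embedding E -> R) : R :=
  let: (xc, xd, xt, xsc, xsd) := x in
  \sum_(Ac : {set E}) \sum_(Ad : {set E}) \sum_(At : {set E})
  \sum_(Asc : {set E})
  \sum_(Asd : {set E} | ordered_partition (edges G) [:: Ac; Ad; At; Asc; Asd])
    xc ^+ #|Ac| * xd ^+ #|Ad| * xt ^+ #|At| * xsc ^+ #|Asc| * xsd ^+ #|Asd| *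
    psi (on_set (@Qsuperdelete E) Asd
          (on_set (@Qsupercontract E) Asc
            (on_set (@Qtwist_contract E) At
              (on_set (@Qdelete E) Ad
                (on_set (@Qcontract E) Ac G))))).

(* Main.v *)
(** A term of Psi with a nonempty A_sc or A_sd vanishes, and in the remaining
    terms the Q operations and the BR operations act in the same way on the
    jewel: they smooth along the same colors. Once every edge has been smoothed
    the jewel consists of free loops only; with discrete partitions these loops
    are the vertices of the embedded graph, pairwise nonadjacent, and they are
    also the pinchcomponents. *)
Require Import Defs.
From mathcomp Require Import all_boot all_order all_algebra.
Import GRing.Theory.
Local Open Scope ring_scope.

(** The jewel part of [on_set], with the order [enum A] kept so that Q and BR results have equal
    jewels, not merely isomorphic ones. *)
Definition smooth_set {E : finType} (c : color) (A : {set E}) (J : jewel E) :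
    jewel E :=
  foldl (fun K e => smooth K c e) J (enum A).

Lemma jewel_of_on_set (E : finType) (c : color)
    (op : E -> embedding E -> embedding E)
    (hop : forall e H, jewel_of (op e H) = smooth H c e)
    (A : {set E}) (G : embedding E) :
  jewel_of (on_set op A G) = smooth_set c A G.
Proof.
rewrite /on_set /smooth_set; elim: (enum A) G => //= e s IHs G.
by rewrite IHs hop.
Qed.

Lemma on_set0 (E : finType) (op : E -> embedding E -> embedding E)
    (G : embedding E) : on_set op set0 G = G.
Proof. by rewrite /on_set enum_set0. Qed.

Lemma edges_smooth (E : finType) (c : color) (e : E) (J : jewel E) :
  edges (smooth J c e) \subset edges J :\ e.
Proof.
apply/subsetP => _ /imsetP[x _ ->].
have := valP x; rewrite inE => labx.
by rewrite in_setD1 labx; apply: imset_f.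
Qed.

Lemma edges_smooth_set (E : finType) (c : color) (A : {set E}) (J : jewel E) :
  edges (smooth_set c A J) \subset edges J :\: A.
Proof.
rewrite -[in X in _ \subset X](set_enum A) /smooth_set.
elim: (enum A) J => [|e s IHs] J /=; first by rewrite set_nil setD0.
apply: subset_trans (IHs _) _.
by rewrite set_cons -setDDl setSD ?edges_smooth.
Qed.

(** Each [BRop] resets the partition to the discrete one; the hypothesis covers an empty [A]. *)
Lemma vpart_on_set_BRop (E : finType) (c : color) (A : {set E})
    (G : embedding E) :
  vpart G = discrete_part G Cv ->
  vpart (on_set (@BRop E c) A G) = discrete_part (on_set (@BRop E c) A G) Cv.
Proof. by rewrite /on_set; elim: (enum A) G => //= e s IHs G _; apply: IHs. Qed.

(** Every element is its own root, since a nontrivial path to the root would start with an edge. *)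
Lemma n_comp_edgeless (T : finType) (e : rel T) (a : {pred T}) :
  (forall x y, ~~ e x y) -> n_comp e a = #|a|.
Proof.
move=> e0; apply: eq_card => x; rewrite !inE andbC.
case: (x \in a) => //=; rewrite /roots /in_mem /=.
have /connectP[[|y p] /=] := connect_root e x; first by move=> _ ->; rewrite eqxx.
by rewrite (negPf (e0 _ _)).
Qed.

Lemma num_components_edgeless (E : finType) (H : embedding E) :
  vpart H = discrete_part H Cv -> edges H = set0 ->
  num_components H = num_pinchcomponents H.
Proof.
move=> discH H0.
(* Every jewel vertex carries an edge label. Without vertices both relations are empty and the only
   v-gons are the singletons of free loops. *)
have noV (x : vert H) : False.
  have: lab H x \in edges H by apply: imset_f.
  by rewrite H0 inE.
rewrite /num_components /num_pinchcomponents !n_comp_edgeless; last 2 first.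
- move=> p q /=; apply/and3P => -[_ _ /existsP[e /andP[/existsP[g]]]].
  by case/andP=> _ /existsP[x]; case: (noV x).
- by move=> x; case: (noV x).
rewrite (eq_card0 (A := predT)) => [|x]; last by case: (noV x).
rewrite discH /discrete_part card_imset; last exact: set1_inj.
rewrite /gons (_ : [set gon_at Cv x | x : vert H] = set0); last first.
  by apply/setP => g; rewrite inE; apply/imsetP => -[x]; case: (noV x).
by rewrite set0U card_imset // => k l /set1_inj [].
Qed.

Lemma ordered_partition_rcons0 (E : finType) (S : {set E}) (As : seq {set E}) :
  ordered_partition S (rcons As set0) = ordered_partition S As.
Proof.
rewrite /ordered_partition big_rcons /= setU0 pairwise_rcons.
by congr (_ && _); rewrite (_ : all _ _) //; apply/allP => A _; rewrite -setI_eq0 setI0.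
Qed.

(** By the convention [0 ^+ 0 = 1], a zero weight leaves only the empty set. *)
Lemma big_expr0 (R : comNzRingType) (E : finType) (P : pred {set E})
    (a : R) (F : {set E} -> R) :
  \sum_(A | P A) a * 0 ^+ #|A| * F A = if P set0 then a * F set0 else 0.
Proof.
rewrite big_mkcond (bigD1 set0) //= cards0 expr0 mulr1 big1 ?addr0 // => A A0.
by rewrite expr0n cards_eq0 (negPf A0) mulr0 mul0r; case: ifP.
Qed.

Theorem mainTheorem2 (R : comNzRingType) (E : finType) (G : embedding E)
    (hG : cellular_embedding G) (alpha beta gamma t : R) :
  Qpoly G (alpha, beta, gamma) t =
  Psi G (alpha, beta, gamma, 0, 0) (0, 0, 0, 0, 0) (psi_p t).
Proof.
case: hG => _ _ discG _; rewrite /Qpoly /Psi.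
apply: eq_bigr => A _; apply: eq_bigr => B _.
(* The condition on [C] becomes an [if], because in [Psi] the set [C] ranges freely and only the
   innermost sum is constrained. *)
rewrite big_mkcond; apply: eq_bigr => C _.
under eq_bigr => Asc _ do rewrite big_expr0 -/(rcons [:: A; B; C; Asc] set0)
  ordered_partition_rcons0.
(* The [if] left by the sum over [Asd] is turned back into a filter on [Asc], so that this sum
   collapses too. *)
rewrite -big_mkcond big_expr0 -/(rcons [:: A; B; C] set0) ordered_partition_rcons0.
case: ifP => // /andP[/eqP ABC _]; congr (_ * _).
rewrite !on_set0.
set H := on_set _ C _; set K := on_set _ C _.
have jewelH : jewel_of H = smooth_set Cz C (smooth_set Cv B (smooth_set Cf A G)).
  rewrite (jewel_of_on_set _ Cz (@BRtwist_contract E)) //.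
  rewrite (jewel_of_on_set _ Cv (@BRdelete E)) //.
  by rewrite (jewel_of_on_set _ Cf (@BRcontract E)).
(* [H] is the BR result and [K] the Q result. Their partitions may differ, but pinchcomponents are
   counted on the jewel alone. *)
have jewelK : jewel_of K = jewel_of H.
  rewrite jewelH.
  rewrite (jewel_of_on_set _ Cz (@Qtwist_contract E)) //.
  rewrite (jewel_of_on_set _ Cv (@Qdelete E)) //.
  by rewrite (jewel_of_on_set _ Cf (@Qcontract E)).
rewrite /psi_p num_components_edgeless; last 2 first.
- by do 3!apply: vpart_on_set_BRop.
- apply/eqP; rewrite -subset0 jewelH.
  apply: subset_trans (edges_smooth_set _ _ _ _) _.
  apply: subset_trans (setSD _ (edges_smooth_set _ _ _ _)) _.
  apply: subset_trans (setSD _ (setSD _ (edges_smooth_set _ _ _ _))) _.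
  (* The three sets cover [edges G], so removing them leaves no label. *)
  rewrite -ABC !big_cons big_nil setU0 !setDDl.
  by rewrite subset0 setD_eq0 setUA.
by rewrite /num_pinchcomponents jewelK.
Qed.
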